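(* Let $r\ge3$ and let $\ell_1\ge0$ be the top Lyapunov exponent of $\mathcal W$, i.e. the number such that for $\mu_{\mathcal W}$-a.e. trajectory $\theta_1,\theta_2,\dots$ of $\mathcal W$ one has $\lim_{n\to\infty}\frac1n\log\|M(g_{\theta_n})\cdots M(g_{\theta_1})\|=\ell_1$. Then $\ell_1>0$.
   Context: $F_r$ is the free group with fixed free basis $A=\{a_1,\dots,a_r\}$. A standard Nielsen automorphism $\theta=[x\mapsto yx]$ (where $x,y\in A^{\pm1}$, $y\ne x^{\pm1}$) is the automorphism with $\theta(x)=yx$ and $\theta(z)=z$ for $z\in A^{\pm1}\setminus\{x,x^{-1}\}$; $S$ is the set of all of these. An ordered pair $([x\mapsto yx],[x'\mapsto y'x'])$ is admissible if either $x'=x$ and $y'\ne y^{-1}$, or $y'=x$ and $x'\ne y^{-1}$. For each $\theta\in S$ exactly $4r-6$ elements $\theta'\in S$ have $(\theta,\theta')$ admissible. $\mathcal W$ is the Markov chain with state set $S$, uniform initial distribution, and transition probability from $\theta$ to $\theta'$ equal to $1/(4r-6)$ if $(\theta,\theta')$ is admissible and $0$ otherwise; $\mu_{\mathcal W}$ is the corresponding probability measure on the space $S^{\mathbb N}$ of trajectories. The rose $R_r$ is the wedge of $r$ loop-edges $e_1,\dots,e_r$ labelled $a_1,\dots,a_r$. For $\theta=[x\mapsto yx]$, $g_\theta:R_r\to R_r$ is the graph map sending the oriented edge $x$ to the edge-path $yx$ and fixing the other edges. The transition matrix $M(f)$ of a graph map $f:R_r\to R_r$ is the $r\times r$ matrix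 whose $(i,j)$ entry is the number of occurrences of $e_i$ and $\overline{e_i}$ in the edge-path $f(e_j)$. $\|\cdot\|$ is the operator norm on $r\times r$ matrices associated with the Euclidean norm on $\mathbb R^r$. The almost sure limit defining $\ell_1$ exists and is constant. *)

(* Defs.v *)
From HB Require Import structures.
From mathcomp Require Import all_boot all_order all_algebra.
From mathcomp Require Import all_classical all_reals all_analysis.
From mathcomp Require Import zify.

Set Implicit Arguments.
Unset Strict Implicit.
Unset Printing Implicit Defensive.

Import Order.TTheory GRing.Theory Num.Theory.
Import numFieldNormedType.Exports.

Local Open Scope classical_set_scope.
Local Open Scope ring_scope.

(* An element of A^{+-1}: (i, true) is a_i, (i, false) is a_i^{-1}.  The same
   type serves for the oriented edges of the rose, (i, true) being e_i and
   (i, false) being e_i with the opposite orientation. *)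
Notation letter r := ('I_r * bool)%type.

Definition linv r (x : letter r) : letter r := (x.1, ~~ x.2).

Definition path_inv r (p : seq (letter r)) : seq (letter r) :=
  rev (map (@linv r) p).

(* The standard Nielsen automorphism [x |-> y x] is encoded by the pair (x, y);
   distinct pairs give distinct automorphisms, see nielsen_map_inj below. *)
Record nielsen (r : nat) := Nielsen {
  nielsen_pair : letter r * letter r;
  _ : (nielsen_pair.2 != nielsen_pair.1) &&
      (nielsen_pair.2 != linv nielsen_pair.1) }.

HB.instance Definition _ r := [isSub for @nielsen_pair r].
HB.instance Definition _ r := [Finite of nielsen r by <:].

Definition nx r (th : nielsen r) : letter r := (nielsen_pair th).1.
Definition ny r (th : nielsen r) : letter r := (nielsen_pair th).2.

Definition admissible r (th th' : nielsen r) : bool :=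
  ((nx th' == nx th) && (ny th' != linv (ny th))) ||
  ((ny th' == nx th) && (nx th' != linv (ny th))).

(* The graph map g_theta, as a map from oriented edges to edge-paths; on the
   reversed edge x^{-1} it takes the reversed path x^{-1} y^{-1}.  Read as words,
   these paths are the reduced words representing theta on A^{+-1}. *)
Definition nielsen_map r (th : nielsen r) (z : letter r) : seq (letter r) :=
  if z == nx th then [:: ny th; nx th]
  else if z == linv (nx th) then path_inv [:: ny th; nx th]
  else [:: z].

Definition transition_matrix (R : realType) r
    (f : letter r -> seq (letter r)) : 'M[R]_r :=
  \matrix_(i < r, j < r) (count (fun z : letter r => z.1 == i) (f (j, true)))%:R.

Definition enorm (R : realType) r (v : 'cV[R]_r) : R :=
  Num.sqrt (\sum_(i < r) v i 0 ^+ 2).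

Definition opnorm (R : realType) r (M : 'M[R]_r) : R :=
  sup [set enorm (M *m v) | v in [set v : 'cV[R]_r | enorm v <= 1]].

Definition trans_prob (R : realType) r (th th' : nielsen r) : R :=
  if admissible th th' then (4 * r - 6)%:R^-1 else 0.

(* [x |-> y x] with x, y the first two basis elements; measurable types must be
   pointed, hence the dependency of trajectory on a proof of 3 <= r. *)
Lemma nielsen_default_subproof r (hr : (3 <= r)%N) :
  let p : letter r * letter r :=
    ((Ordinal (ltnW (ltnW hr)), true),
     (Ordinal (ltnW hr), true)) in
  (p.2 != p.1) && (p.2 != linv p.1).
Proof. by []. Qed.

Definition nielsen_default r (hr : (3 <= r)%N) : nielsen r :=
  Nielsen (nielsen_default_subproof hr).

Definition trajectory r (hr : (3 <= r)%N) : Type := nat -> nielsen r.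

HB.instance Definition _ r (hr : (3 <= r)%N) := gen_eqMixin (trajectory hr).
HB.instance Definition _ r (hr : (3 <= r)%N) := gen_choiceMixin (trajectory hr).
HB.instance Definition _ r (hr : (3 <= r)%N) :=
  isPointed.Build (trajectory hr) (fun=> nielsen_default hr).

Definition coordinate_sets r (hr : (3 <= r)%N) : set (set (trajectory hr)) :=
  [set C | exists (n : nat) (th : nielsen r),
     C = [set w : trajectory hr | w n = th]].

(* The trajectory space with the product sigma-algebra of the discrete ones; the
   entry theta_k of a trajectory w is w k.-1. *)
Notation trajectory_space hr := (g_sigma_algebraType (@coordinate_sets _ hr)).

(* These values on cylinder sets determine mu_W uniquely. *)
Definition is_walk_measure (R : realType) r (hr : (3 <= r)%N)
    (mu : probability (trajectory_space hr) R) : Prop :=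
  forall (n : nat) (s : nat -> nielsen r),
    mu [set w : trajectory_space hr | forall i, (i <= n)%N -> w i = s i] =
    ((#|{: nielsen r}|%:R)^-1 *
     \prod_(i < n) trans_prob R (s i) (s i.+1))%:E.

Fixpoint walk_product (R : realType) r (w : nat -> nielsen r) (n : nat) : 'M[R]_r :=
  if n is m.+1 then transition_matrix R (nielsen_map (w m)) *m walk_product R w m
  else 1%:M.

Definition is_top_lyapunov (R : realType) r (hr : (3 <= r)%N)
    (mu : probability (trajectory_space hr) R) (l : R) : Prop :=
  {ae mu, forall w : trajectory_space hr,
    (fun n : nat => n%:R^-1 * ln (opnorm (walk_product R w n))) @ \oo --> l}.

Lemma linvK r : involutive (@linv r).
Proof. by case=> i b; rewrite /linv /= negbK. Qed.

Lemma linv_neq r (x : letter r) : linv x != x.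
Proof. by case: x => i []; rewrite /linv xpair_eqE /= andbF. Qed.

Lemma nielsen_map_inj r (th th' : nielsen r) :
  nielsen_map th =1 nielsen_map th' -> th = th'.
Proof.
case: th th' => [[x y] h] [[x' y'] h'] /(_ x) /=.
rewrite /nielsen_map /nx /ny /= eqxx /path_inv /rev /= => e.
apply: val_inj => /=; move: e.
case: (x =P x') => [-> [-> //]|_].
case: (x =P linv x') => // <- [yx _].
by case/andP: h => /eqP.
Qed.

Lemma card_admissible r (th : nielsen r) :
  #|[set th' : nielsen r | admissible th th']%SET| = (4 * r - 6)%N.
Proof.
case: th => [[x y] /= hxy]; have /andP[yx yx'] := hxy.
pose D : {set letter r} := ~: [set x; linv x; linv y].
have cD : #|D| = (2 * r - 3)%N.
  have e : linv y != x by apply: contraNneq yx' => <-; rewrite linvK.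
  have e' : linv y != linv x by rewrite (inj_eq (inv_inj (@linvK r))).
  rewrite cardsCs finset.setCK card_prod card_ord card_bool mulnC.
  congr (_ - _)%N.
  rewrite finset.setUC !cardsU1 !inE cards1 (negPf e) (negPf e') /=.
  by rewrite eq_sym (negPf (linv_neq x)).
pose E1 := [set ((x, z) : letter r * letter r) | z in D]%SET.
pose E2 := [set ((z, x) : letter r * letter r) | z in D]%SET.
have dE : (E1 :&: E2 = finset.set0)%SET.
  apply/setP => p; rewrite !inE; apply/negP.
  move=> /andP[/imsetP[z _ ->] /imsetP[z' z'D [xz' _]]].
  by move: z'D; rewrite -xz' !inE eqxx.
transitivity #|(E1 :|: E2)%SET|; last first.
  rewrite cardsU dE cards0 subn0.
  rewrite !card_imset ?cD; [lia|by move=> a b []|by move=> a b []].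
rewrite -(card_imset _ (val_inj : injective (@nielsen_pair r))).
congr #|pred_of_set _|; apply/setP => -[a b]; apply/imsetP/setUP.
- case=> -[[c d] h]; rewrite inE /admissible /nx /ny /=.
  move=> /[swap] -[-> ->] /orP[] /andP[/eqP ? nxy]; subst; [left|right];
    apply: imset_f; case/andP: h => /= h1 h2; rewrite !inE.
  + by rewrite (negPf h1) (negPf h2).
  + rewrite (eq_sym c) (negPf h1) negb_or nxy andbT negb_or /=.
    by apply: contraNneq h2 => ->; rewrite linvK.
- case=> /imsetP[z]; rewrite !inE !negb_or => /andP[/andP[z1 z2] z3] [-> ->].
  + have h : (z != x) && (z != linv x) by rewrite z1 z2.
    exists (@Nielsen r (x, z) h) => //.
    by rewrite inE /admissible /nx /ny /= eqxx z3.
  + have h : (x != z) && (x != linv z).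
      by rewrite eq_sym z1; apply: contraNneq z2 => ->; rewrite linvK.
    exists (@Nielsen r (z, x) h) => //.
    by rewrite inE /admissible /nx /ny /= eqxx z3 orbT.
Qed.

(* Main.v *)
Require Import Defs.
From HB Require Import structures.
From mathcomp Require Import all_boot all_order all_algebra.
From mathcomp Require Import all_classical all_reals all_analysis.
From mathcomp Require Import measurable_realfun.
Import Order.TTheory GRing.Theory Num.Theory.
Import numFieldNormedType.Exports.
Local Open Scope ring_scope.

(* The matrix of [x |-> y x] adds the x-coordinate of a vector to its
   y-coordinate.  Apply the product of the first n matrices to the all-ones
   vector: the sum of the coordinates of the result never decreases, and it grows
   by the factor 1 + 1/r whenever the next x carries a largest coordinate.  Every
   state has an admissible successor whose x has any prescribed index, so,
   whatever the past, such a step happens with conditional probability at least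
   p = 1 / (4 r - 6).  The frequency of these steps thus has mean about p; if l1
   were 0 it would tend to 0 almost surely, against dominated convergence. *)

Lemma mulrn_sum_ord (V : nmodType) (n : nat) (x : V) : x *+ n = \sum_(i < n) x.
Proof. by rewrite sumr_const card_ord. Qed.

(** Occurrences are counted up to orientation, so the matrix is the identity plus one elementary
    matrix. *)
Lemma transition_matrix_nielsen (R : realType) (r : nat) (th : nielsen r)
    (i j : 'I_r) :
  transition_matrix R (nielsen_map th) i j =
  (i == j)%:R + ((i == (ny th).1) && (j == (nx th).1))%:R.
Proof.
rewrite mxE /nielsen_map; case: th => -[[x a] [y b]] h.
rewrite /nx /ny /path_inv /linv /rev /= !xpair_eqE.
have [<-|nxj] /= := eqVneq j x; last by rewrite andbF addr0 /= addn0 eq_sym.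
rewrite andbT (eq_sym i j) (eq_sym i y).
by case: a h => h; rewrite /= addn0 natrD // addrC.
Qed.

(** * Growth of the coordinate sum *)

Section mass.
Context {R : realType} {r : nat}.
Implicit Types (v : 'cV[R]_r) (th : nielsen r) (w : nat -> nielsen r).

Definition mass v : R := \sum_i v i 0.

Lemma transition_matrix_mulE th v i :
  (transition_matrix R (nielsen_map th) *m v) i 0 =
  v i 0 + (i == (ny th).1)%:R * v (nx th).1 0.
Proof.
rewrite mxE; under eq_bigr do rewrite transition_matrix_nielsen mulrDl.
rewrite big_split /=; congr (_ + _).
  rewrite (bigD1 i) //= eqxx mul1r big1 ?addr0 // => j ji.
  by rewrite eq_sym (negPf ji) mul0r.
rewrite (bigD1 (nx th).1) //= eqxx andbT big1 ?addr0 // => j ji.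
by rewrite (negPf ji) andbF mul0r.
Qed.

Lemma mass_transition_matrix_mul th v :
  mass (transition_matrix R (nielsen_map th) *m v) = mass v + v (nx th).1 0.
Proof.
rewrite /mass; under eq_bigr do rewrite transition_matrix_mulE.
rewrite big_split /=; congr (_ + _).
rewrite (bigD1 (ny th).1) //= eqxx mul1r big1 ?addr0 // => j ji.
by rewrite (negPf ji) mul0r.
Qed.

(** If every coordinate were below the average, summing over [i] would give
    [r * mass v < r * mass v]. *)
Lemma mass_le_coord v : (0 < r)%N -> exists i, mass v <= r%:R * v i 0.
Proof.
move=> r0; apply: contrapT => h.
have : \sum_(i < r) r%:R * v i 0 < mass v *+ r.
  rewrite [mass v *+ r]mulrn_sum_ord; apply: ltr_sum => [|i _].
    by apply/hasP; exists (Ordinal r0); rewrite ?mem_index_enum.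
  by rewrite ltNge; apply/negP => vi; apply: h; exists i.
by rewrite -mulr_sumr mulr_natl ltxx.
Qed.

Definition walk_vec w n : 'cV[R]_r := walk_product R w n *m const_mx 1.

Lemma walk_vecS w n :
  walk_vec w n.+1 = transition_matrix R (nielsen_map (w n)) *m walk_vec w n.
Proof. by rewrite /walk_vec /= mulmxA. Qed.

Lemma walk_vec_ge1 w n i : 1 <= walk_vec w n i 0.
Proof.
elim: n i => [|n IH] i; first by rewrite /walk_vec /= mul1mx mxE.
rewrite walk_vecS transition_matrix_mulE (le_trans (IH i)) // lerDl.
by rewrite mulr_ge0 // (le_trans ler01 (IH _)).
Qed.

Lemma mass_walk_vec_ge1 w n : (0 < r)%N -> 1 <= mass (walk_vec w n).
Proof.
move=> r0; apply: (@le_trans _ _ (r%:R)); first by rewrite ler1n.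
rewrite mulrn_sum_ord; apply: ler_sum => i _.
exact: walk_vec_ge1.
Qed.

Lemma eq_walk_vec w w' n :
  (forall i, (i < n)%N -> w i = w' i) -> walk_vec w n = walk_vec w' n.
Proof.
elim: n => [//|n IH] h; rewrite !walk_vecS h // IH // => i ni.
exact/h/ltnW.
Qed.

Lemma abs_coord_le_enorm v i : `|v i 0| <= enorm v.
Proof.
rewrite -sqrtr_sqr ler_wsqrtr //.
by rewrite (bigD1 i) //= lerDl sumr_ge0 // => j _; rewrite sqr_ge0.
Qed.

Lemma coord_le_enorm v i : v i 0 <= enorm v.
Proof. exact: le_trans (ler_norm _) (abs_coord_le_enorm _ _). Qed.

Lemma enorm_mul_le_opnorm (M : 'M[R]_r) v :
  enorm v <= 1 -> enorm (M *m v) <= opnorm M.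
Proof.
move=> v1; apply: ub_le_sup; last by exists v.
(* [sup] dominates its set only if that set is bounded: coordinates of [u] are at most 1 in absolute
   value, so the absolute row sums of [M] bound those of [M *m u]. *)
exists (Num.sqrt (\sum_i (\sum_j `|M i j|) ^+ 2)) => _ [u /= u1 <-].
rewrite ler_wsqrtr //; apply: ler_sum => i _; rewrite -real_normK ?num_real //.
rewrite lerXn2r ?nnegrE ?sumr_ge0 // mxE (le_trans (ler_norm_sum _ _ _)) //.
apply: ler_sum => j _; rewrite normrM ler_piMr //.
exact: le_trans (abs_coord_le_enorm _ _) u1.
Qed.

(** One factor [r] rescales the all-ones vector into the unit ball; the other counts the coordinates
    summed. *)
Lemma mass_walk_vec_le w n : (0 < r)%N ->
  mass (walk_vec w n) <= r%:R ^+ 2 * opnorm (walk_product R w n).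
Proof.
move=> r0; have rn0 : 0 < r%:R :> R by rewrite ltr0n.
pose u : 'cV[R]_r := const_mx r%:R^-1.
have uE : const_mx 1 = r%:R *: u.
  by apply/matrixP => i j; rewrite !mxE divff ?gt_eqF.
have u1 : enorm u <= 1.
  rewrite -[leRHS]sqrtr1 ler_wsqrtr //.
  under eq_bigr do rewrite mxE.
  rewrite -mulrn_sum_ord -[_ ^+ 2 *+ r]mulr_natl expr2 mulrA divff ?gt_eqF // mul1r.
  by rewrite invf_le1 // ler1n.
rewrite /walk_vec uE -scalemxAr /mass.
under eq_bigr do rewrite mxE.
rewrite -mulr_sumr expr2 -mulrA ler_pM2l //.
rewrite mulr_natl [_ *+ r]mulrn_sum_ord.
apply: ler_sum => i _.
exact: le_trans (coord_le_enorm _ _) (enorm_mul_le_opnorm _ _ u1).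
Qed.

Lemma admissible_heavy th v : (3 <= r)%N ->
  exists th' : nielsen r,
    admissible th th' && (mass v <= r%:R * v (nx th').1 0).
Proof.
move=> hr; have [i vi] := mass_le_coord v (ltnW (ltnW hr)).
suff [th' ath' xi] : exists2 th' : nielsen r, admissible th th' & (nx th').1 = i.
  by exists th'; rewrite ath' xi.
have [xi|xi] := eqVneq (nx th).1 i.
  by exists th; rewrite // /admissible eqxx eq_sym linv_neq.
(* The new [y] is the old [x]; the new [x] gets the sign of the old [y], hence differs from the
   inverse of that [y]. *)
have h : (nx th != (i, (ny th).2)) && (nx th != linv (i, (ny th).2)).
  by rewrite -!pair_eqE /= /pair_eq (negPf xi).
exists (@Nielsen r ((i, (ny th).2), nx th) h) => //.
rewrite /admissible /nx /ny /= eqxx; apply/orP; right => /=.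
by rewrite /linv xpair_eqE negb_and; case: (_.2.2); rewrite orbT.
Qed.

(** The vector at [n.+1] has absorbed exactly [w 0] to [w n], so this candidate for the state at
    time [n.+1] is a function of the past. *)
Definition heavy_step w n : nielsen r :=
  let v := walk_vec w n.+1 in
  odflt (w n)
    [pick th' | admissible (w n) th' & mass v <= r%:R * v (nx th').1 0].

Lemma heavy_stepP w n : (3 <= r)%N ->
  admissible (w n) (heavy_step w n) /\
  mass (walk_vec w n.+1) <= r%:R * walk_vec w n.+1 (nx (heavy_step w n)).1 0.
Proof.
move=> hr; rewrite /heavy_step; case: pickP => [th' /andP[]//|h].
by have [th'] := admissible_heavy (w n) (walk_vec w n.+1) hr; rewrite h.
Qed.

Lemma eq_heavy_step w w' n :
  (forall i, (i <= n)%N -> w i = w' i) -> heavy_step w n = heavy_step w' n.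
Proof. by move=> h; rewrite /heavy_step (eq_walk_vec w w' n.+1 h) h. Qed.

(** A step agreeing with [heavy_step] adds at least [1/r] of the current mass; any other step adds a
    positive coordinate. The step [w 0] is not counted. *)
Lemma mass_walk_vec_lower w n : (3 <= r)%N ->
  (1 + r%:R^-1) ^+ (\sum_(k < n) (w k.+1 == heavy_step w k))
    <= mass (walk_vec w n.+1).
Proof.
move=> hr; have r0 : (0 < r)%N by exact: ltnW (ltnW hr).
elim: n => [|n IH]; first by rewrite big_ord0 mass_walk_vec_ge1.
rewrite big_ord_recr /= walk_vecS mass_transition_matrix_mul.
have [_ hv] := heavy_stepP w n hr.
have [->|_] := eqVneq (w n.+1) (heavy_step w n); last first.
  by rewrite addn0 (le_trans IH) // lerDl (le_trans ler01) // walk_vec_ge1.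
rewrite addn1 exprSr mulrDr mulr1 lerD // ler_pdivrMr ?ltr0n // mulrC.
exact: le_trans IH hv.
Qed.

End mass.

(** * Conditioning on the past of the walk *)

Section walk.
Context {R : realType} {r : nat} {hr : (3 <= r)%N}.
Context {mu : probability (trajectory_space hr) R} (hmu : is_walk_measure mu).
Local Open Scope classical_set_scope.

Definition cylinder n (s : nat -> nielsen r) : set (trajectory_space hr) :=
  [set w | forall i, (i <= n)%N -> w i = s i].

Lemma measurable_cylinder n s : measurable (cylinder n s).
Proof.
have -> : cylinder n s =
    \bigcap_(i in [set i | (i <= n)%N]) [set w : trajectory_space hr | w i = s i].
  by apply/seteqP; split.
by apply: bigcap_measurableType => i _; apply: sub_gen_smallest; exists i, (s i).
Qed.

(** Cylinders take infinite sequences; [inord] pads the word beyond [n], where [cylinder n] does not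
    look. *)
Definition word_ext n (t : {ffun 'I_n.+1 -> nielsen r}) : nat -> nielsen r :=
  fun i => t (inord i).

Lemma cylinder_word_ext n t w : cylinder n (word_ext n t) w <->
  t = [ffun i : 'I_n.+1 => w i].
Proof.
split=> [h|-> i ni]; last by rewrite /word_ext ffunE inordK.
by apply/ffunP => i; rewrite ffunE h -1?ltnS // /word_ext inord_val.
Qed.

Lemma bigcup_cylinder n : \bigcup_t cylinder n (word_ext n t) = setT.
Proof.
apply/seteqP; split=> // w _.
by exists [ffun i : 'I_n.+1 => w i] => //; apply/cylinder_word_ext.
Qed.

(** A trajectory determines its initial word, so these finitely many pieces are disjoint. *)
Lemma measure_bigcup_cylinder n
    (A : {ffun 'I_n.+1 -> nielsen r} -> set (trajectory_space hr)) :
  (forall t, measurable (A t)) -> (forall t, A t `<=` cylinder n (word_ext n t)) ->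
  mu (\bigcup_t A t) = (\sum_(t \in setT) mu (A t))%E.
Proof.
move=> mA sA; apply: measure_fin_bigcup => //; first exact: finite_finset.
move=> t t' _ _ [w [/sA/cylinder_word_ext -> /sA/cylinder_word_ext ->]] //.
Qed.

Definition append n (s : nat -> nielsen r) x : nat -> nielsen r :=
  fun i => if (i <= n)%N then s i else x.

(** Appending a state appends one factor to the product of transition probabilities. *)
Lemma walk_measure_append n s x : admissible (s n) x ->
  mu (cylinder n.+1 (append n s x)) =
  ((4 * r - 6)%:R^-1%:E * mu (cylinder n s))%E.
Proof.
move=> sx; rewrite /cylinder !hmu -EFinM; congr EFin.
rewrite big_ord_recr /= {3 4}/append leqnn ltnn /trans_prob sx.
rewrite mulrA mulrC; congr (_ * (_ * _)); apply: eq_bigr => i _.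
by rewrite /append (ltnW (ltn_ord i)) ltn_ord.
Qed.

Section step.
Variables (n : nat) (f : (nat -> nielsen r) -> nielsen r).
Hypothesis eq_f : forall w w', (forall i, (i <= n)%N -> w i = w' i) -> f w = f w'.

Let next (t : {ffun 'I_n.+1 -> nielsen r}) :=
  cylinder n.+1 (append n (word_ext n t) (f (word_ext n t))).

(** Once the first [n.+1] entries are fixed, so is [f w]: each past contributes one cylinder. *)
Let step_bigcup :
  [set w : trajectory_space hr | w n.+1 = f w] = \bigcup_t next t.
Proof.
apply/seteqP; split => w /=.
  move=> wn; exists [ffun i : 'I_n.+1 => w i] => // i.
  have h : forall j, (j <= n)%N -> w j = word_ext n [ffun i : 'I_n.+1 => w i] j.
    by move=> j jn; rewrite /word_ext ffunE inordK.
  rewrite /append leq_eqVlt ltnS => /orP[/eqP ->|jn]; last by rewrite jn h.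
  by rewrite ltnn wn; apply: eq_f.
case=> t _ h; rewrite h // /append ltnn; apply/esym/eq_f => i ni.
by rewrite h ?(leqW ni) // /append ni.
Qed.

Lemma measurable_step : measurable [set w : trajectory_space hr | w n.+1 = f w].
Proof.
rewrite step_bigcup; apply: fin_bigcup_measurable => [|t _]; first exact: finite_finset.
exact: measurable_cylinder.
Qed.

(** Each past passes on the same fraction of its measure, and the cylinders of all pasts have total
    measure 1. *)
Lemma walk_measure_step : (forall w, admissible (w n) (f w)) ->
  mu [set w : trajectory_space hr | w n.+1 = f w] = (4 * r - 6)%:R^-1%:E.
Proof.
move=> adm; rewrite step_bigcup measure_bigcup_cylinder; first last.
- by move=> t w h i ni; rewrite h ?(leqW ni) // /append ni.
- by move=> t; apply: measurable_cylinder.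
under eq_fsbigr do rewrite walk_measure_append //.
rewrite -ge0_mule_fsumr; last by move=> t; exact: measure_ge0.
rewrite -measure_bigcup_cylinder => [|t|t w h]; last 2 first.
- exact: measurable_cylinder.
- exact: h.
by rewrite bigcup_cylinder probability_setT mule1.
Qed.

End step.

(** * Frequency of heavy steps *)

Let heavy k := [set w : trajectory_space hr | w k.+1 = heavy_step (R := R) w k].

Let measurable_heavy k : measurable (heavy k).
Proof. by apply: measurable_step => w w'; exact: eq_heavy_step. Qed.

Let walk_measure_heavy k : mu (heavy k) = (4 * r - 6)%:R^-1%:E.
Proof.
apply: walk_measure_step => [w w'|w]; first exact: eq_heavy_step.
by case: (@heavy_stepP R r w k hr).
Qed.

(** The divisor is [n.+1], not the number [n] of terms, to match the average over [n.+1] matrices in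
    the Lyapunov limit. *)
Definition heavy_freq n (w : trajectory_space hr) : R :=
  n.+1%:R^-1 * (\sum_(k < n) (w k.+1 == heavy_step (R := R) w k))%:R.

Lemma heavy_freqE n :
  heavy_freq n = (fun w => n.+1%:R^-1 * \sum_(k < n) \1_(heavy k) w).
Proof.
apply/funext => w; rewrite /heavy_freq natr_sum; congr (_ * _).
apply: eq_bigr => k _; rewrite indicE; congr (nat_of_bool _)%:R.
by apply/eqP/idP; rewrite inE.
Qed.

Lemma heavy_freq_ge0 n w : 0 <= heavy_freq n w.
Proof. by rewrite mulr_ge0. Qed.

Lemma heavy_freq_le1 n w : heavy_freq n w <= 1.
Proof.
rewrite /heavy_freq mulrC ler_pdivrMr // mul1r ler_nat.
apply: (@leq_trans (\sum_(k < n) 1)%N); last by rewrite sum1_card card_ord.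
by apply: leq_sum => k _; exact: leq_b1.
Qed.

Lemma measurable_heavy_freq n : measurable_fun setT (heavy_freq n).
Proof.
rewrite heavy_freqE; apply: measurable_funM => //; apply: measurable_sum => k.
exact/measurable_indic.
Qed.

Lemma integral_heavy_freq n :
  (\int[mu]_w (heavy_freq n w)%:E = (n%:R / n.+1%:R / (4 * r - 6)%:R)%:E)%E.
Proof.
rewrite heavy_freqE; under eq_integral do rewrite EFinM -sumEFin.
rewrite ge0_integralZl_EFin //; first last.
- apply: emeasurable_sum => k; exact/measurable_EFinP/measurable_indic.
- by move=> w _; apply: sume_ge0 => k _; rewrite lee_fin.
rewrite ge0_integral_sum //; last first.
  by move=> k; exact/measurable_EFinP/measurable_indic.
under eq_bigr do rewrite integral_indic // setIT.
rewrite (eq_bigr (fun=> (4 * r - 6)%:R^-1%:E)) => [|k _]; last first.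
  exact: walk_measure_heavy.
rewrite sumEFin -mulrn_sum_ord -EFinM -[_^-1 *+ n]mulr_natl; congr EFin.
by rewrite mulrA [_^-1 * _]mulrC.
Qed.

(** This compares the logarithms of the lower and upper bounds on the mass after [n.+1] steps. *)
Lemma heavy_freq_le n w : heavy_freq n w * ln (1 + r%:R^-1) <=
  n.+1%:R^-1 * ln (r%:R ^+ 2) + n.+1%:R^-1 * ln (opnorm (walk_product R w n.+1)).
Proof.
have r0 : (0 < r)%N by exact: ltnW (ltnW hr).
have rn0 : 0 < r%:R :> R by rewrite ltr0n.
rewrite /heavy_freq -mulrA -mulrDr ler_pM2l ?invr_gt0 //.
have lo := mass_walk_vec_lower (R := R) w n hr.
have up := mass_walk_vec_le (R := R) w n.+1 r0.
have q0 : 0 < 1 + r%:R^-1 :> R by rewrite addr_gt0 // invr_gt0.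
(* [r ^+ 2] times the norm bounds a mass that is at least 1. *)
have op0 : 0 < opnorm (walk_product R w n.+1).
  rewrite -(pmulr_rgt0 _ (exprn_gt0 2 rn0)) (lt_le_trans _ up) //.
  by rewrite (lt_le_trans ltr01) // mass_walk_vec_ge1.
rewrite -lnM ?posrE ?exprn_gt0 // mulr_natl -lnXn //.
by rewrite ler_ln ?posrE ?mulr_gt0 ?exprn_gt0 // (le_trans lo up).
Qed.

(** The frequency is squeezed between 0 and the bound of [heavy_freq_le], both of whose terms vanish
    in the limit. *)
Lemma heavy_freq_cvg0 w :
  (fun n : nat => n%:R^-1 * ln (opnorm (walk_product R w n))) @ \oo --> (0 : R) ->
  heavy_freq ^~ w @ \oo --> (0 : R).
Proof.
rewrite -cvg_shiftS => cl.
have q1 : 0 < ln (1 + r%:R^-1) :> R.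
  by rewrite ln_gt0 // ltrDl invr_gt0 ltr0n (ltnW (ltnW hr)).
apply: (@squeeze_cvgr _ _ _ _ (fun=> 0) (fun n => (n.+1%:R^-1 * ln (r%:R ^+ 2)
  + n.+1%:R^-1 * ln (opnorm (walk_product R w n.+1))) / ln (1 + r%:R^-1))).
- by apply: nearW => n; rewrite heavy_freq_ge0 ler_pdivlMr // heavy_freq_le.
- exact: cvg_cst.
- rewrite -[X in _ --> X](mul0r (ln (1 + r%:R^-1))^-1); apply: cvgMr_tmp.
  rewrite -[X in _ --> X](addr0 0); apply: cvgD => //.
  rewrite -[X in _ --> X](mul0r (ln (r%:R ^+ 2))); apply: cvgMr_tmp.
  exact: cvg_harmonic.
Qed.

End walk.

Theorem proposition5p13 (R : realType) (r : nat) (hr : (3 <= r)%N)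
    (mu : probability (trajectory_space hr) R) (hmu : is_walk_measure mu)
    (l1 : R) (hl1_ge0 : 0 <= l1) (hl1 : is_top_lyapunov mu l1) :
  0 < l1.
Proof.
rewrite lt0r hl1_ge0 andbT; apply/eqP => l0; rewrite {}l0 in hl1.
(* The frequencies tend to 0 almost surely and lie between 0 and 1, so their means tend to 0. *)
have [|||||_ _] := @dominated_convergence _ _ _ mu setT measurableT
  (fun n w => (heavy_freq n w)%:E) (cst 0%E) (cst 1%E).
- by move=> n; apply/measurable_EFinP; apply: measurable_heavy_freq.
- exact: measurable_cst.
- apply: filterS hl1 => w /heavy_freq_cvg0 h _.
  by apply/fine_cvgP; split; [exact: nearW|exact: h].
- exact: finite_measure_integrable_cst.
- apply: nearW => w n _.
  by rewrite abse_EFin lee_fin ger0_norm ?heavy_freq_ge0 ?heavy_freq_le1.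
rewrite integral0; under eq_fun do rewrite (integral_heavy_freq hmu).
move/fine_cvgP => [_]; rewrite /comp /= => c0.
(* The explicit formula gives the same means the limit [1 / (4 r - 6)]. *)
have c1 : ((fun n => n%:R / n.+1%:R / (4 * r - 6)%:R : R) @ \oo -->
    ((4 * r - 6)%:R^-1 : R))%classic.
  rewrite -[X in (_ --> X)%classic]mul1r; apply: cvgMr_tmp.
  have -> : (fun n => n%:R / n.+1%:R : R) = (fun n => 1 - n.+1%:R^-1).
    apply/funext => n; have -> : n%:R = n.+1%:R - 1 :> R by rewrite -natr1 addrK.
    by rewrite mulrBl divff // mul1r.
  rewrite -[X in (_ --> X)%classic]subr0; apply: cvgB; [exact: cvg_cst|exact: cvg_harmonic].
have /esym/eqP : 0 = (4 * r - 6)%:R^-1 :> R.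
  exact: (cvg_unique _ c0 c1).
(* The truncated difference [4 * r - 6] is nonzero because [4 * r] is at least 12. *)
rewrite invr_eq0 pnatr_eq0 subn_eq0; apply/negP; rewrite -ltnNge.
exact: leq_trans (leq_mul (leqnn 4) hr).
Qed.
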